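(* Let $m\le n$, let $\overline A=(\overline a_{ij})\in\mathbb{R}^{m\times n}$ be arbitrary and $\sigma>0$, and let $A\in\mathbb{R}^{m\times n}$ have independent entries $A_{ij}\sim\mathcal N(\overline a_{ij},\sigma^2)$. Then $$\kappa_F(A)\le 98\sigma^2n^3+2n\|\overline A\|^2+\frac{e^2n^4}{\sigma^2}$$ with probability at least $1-\big(\frac{1}{\sqrt n}+e^{-2n/\pi^2}\big)$.
   Context: $\kappa_F(A)=\|A\|_F^2+\|A^\dagger\|_F^2$, where $A^\dagger$ is the Moore–Penrose pseudoinverse; $\|\overline A\|$ is the spectral (operator) norm. *)

(* Defs.v *)
From HB Require Import structures.
From mathcomp Require Import all_boot all_order all_algebra.
From mathcomp Require Import all_classical all_reals all_analysis.
Set Implicit Arguments. Unset Strict Implicit. Unset Printing Implicit Defensive.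
Import Order.TTheory GRing.Theory Num.Theory.
Local Open Scope classical_set_scope.
Local Open Scope ring_scope.

Definition penrose {R : realType} {m n : nat} (A : 'M[R]_(m, n)) (X : 'M[R]_(n, m)) :=
  [/\ A *m X *m A = A, X *m A *m X = X,
      (A *m X)^T = A *m X & (X *m A)^T = X *m A].

Definition mpinv {R : realType} {m n : nat} (A : 'M[R]_(m, n)) : 'M[R]_(n, m) :=
  xget 0 [set X | penrose A X].

Definition frob2 {R : realType} {m n : nat} (A : 'M[R]_(m, n)) : R :=
  \sum_i \sum_j A i j ^+ 2.

Definition kappaF {R : realType} {m n : nat} (A : 'M[R]_(m, n)) : R :=
  frob2 A + frob2 (mpinv A).

Definition vnorm {R : realType} {k : nat} (x : 'cV[R]_k) : R :=
  Num.sqrt (\sum_i x i 0 ^+ 2).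

Definition opnorm {R : realType} {m n : nat} (A : 'M[R]_(m, n)) : R :=
  sup [set vnorm (A *m x) | x in [set x : 'cV[R]_n | vnorm x = 1]].

Definition mutually_independent {d} {T : measurableType d} {R : realType}
  {I : finType} (P : probability T R) (X : I -> {RV P >-> R}) :=
  forall B : I -> set R, (forall i, measurable (B i)) ->
    P (\bigcap_(i in [set: I]) (X i @^-1` B i)) =
    (\prod_(i : I) P (X i @^-1` B i))%E.

(* Main.v *)
(** The matrix [A' := lsubmx A] of the first [m] columns is almost surely
    invertible, and [col_mx (invmx A') 0] is then a right inverse of [A], so its
    Frobenius norm bounds that of the pseudoinverse. The columns of [invmx A']
    have norms [1 / dist_i], with [dist_i] the distance from the [i]-th row of
    [A'] to the span of the others, i.e. [|det A'|] over the norm of the vector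
    of cofactors of that row. These cofactors do not depend on row [i], so
    [det A'] is, given the other rows, a Gaussian linear form; bounding the
    indicator of [L ^+ 2 <= t ^+ 2 * C] by
    [expR (1/2 - L ^+ 2 / (2 * t ^+ 2 * C))] and integrating one entry at a time
    gives [dist_i <= t] with probability at most [sqrt e * t / sigma]. A union
    bound with [t = sigma / (e * n * sqrt n)] costs [1 / sqrt (e * n)], which
    leaves room within [1 / sqrt n] for the probability that
    [frob2 (A - Abar) >= 49 * sigma ^+ 2 * n ^+ 3], at most [6 / (49 * n)] by
    Markov's inequality; the exponential term is not needed. *)
Require Import Defs.
From HB Require Import structures.
From mathcomp Require Import all_boot all_order all_algebra.
From mathcomp Require Import all_classical all_reals all_analysis.
From mathcomp Require Import measurable_realfun ring lra.
Set Implicit Arguments.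
Unset Strict Implicit.
Unset Printing Implicit Defensive.
Import Order.TTheory GRing.Theory Num.Theory.
Local Open Scope classical_set_scope.
Local Open Scope ring_scope.

(** * Product sigma-algebra on configurations and resampling of one coordinate *)

Section Resampling.
Context (R : realType) (I : finType).

Import numFieldTopology.Exports.

Definition box (B : I -> set R) : set (I -> R) := [set g | forall i, B i (g i)].

Definition boxes : set (set (I -> R)) :=
  [set box B | B in [set B | forall i, measurable (B i)]].

(** This is the product sigma-algebra on the functions from [I] to the reals. Its generators, the
    boxes, are stable under intersection, so a probability measure is determined by its values on
    them. *)
Definition cfg : measurableType (sigma_display boxes) :=
  g_sigma_algebraType boxes.

Definition upd (g : cfg) (i : I) (x : R) : cfg :=
  fun j => if j == i then x else g j.

Lemma measurable_box (B : I -> set R) :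
  (forall i, measurable (B i)) -> measurable (box B : set cfg).
Proof. by move=> mB; apply: sub_sigma_algebra; exists B. Qed.

Lemma measurable_coord (i : I) : measurable_fun setT (fun g : cfg => g i).
Proof.
move=> _ B mB; rewrite setTI.
rewrite (_ : _ @^-1` _ = box (fun j => if j == i then B else setT)).
  by apply: measurable_box => j; case: ifP.
apply/seteqP; split=> g /=; last by move/(_ i); rewrite eqxx.
by move=> Bg j; case: eqP => [->|].
Qed.

Lemma setI_closed_boxes : setI_closed boxes.
Proof.
move=> _ _ [B mB <-] [C mC <-]; exists (fun i => B i `&` C i).
  by move=> i; exact: measurableI.
apply/seteqP; split=> g; first by move=> BC; split=> i; case: (BC i).
by move=> [Bg Cg] i; split.
Qed.

Lemma measurable_fun_cfg d (T : measurableType d) (f : T -> cfg) :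
  (forall i, measurable_fun setT (fun w => f w i)) -> measurable_fun setT f.
Proof.
move=> mf; apply: (@measurability _ _ _ cfg _ _ boxes) => //.
move=> _ [_ [B mB <-] <-]; rewrite setTI.
rewrite (_ : _ @^-1` _ = \bigcap_(i in [set: I]) ((f ^~ i) @^-1` B i)).
  apply: fin_bigcap_measurable => // i _.
  by rewrite -[X in measurable X]setTI; apply: mf.
by apply/seteqP; split=> w Bw i; [move=> _; exact: Bw|exact: (Bw i)].
Qed.

Context d (T : measurableType d) (P : probability T R) (X : I -> {RV P >-> R}).
Hypothesis indX : mutually_independent X.

Definition joint (w : T) : cfg := fun i => X i w.

Lemma measurable_joint : measurable_fun setT joint.
Proof. by apply: measurable_fun_cfg => i; exact: measurable_funPT. Qed.

Lemma joint_box (B : I -> set R) : (forall i, measurable (B i)) ->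
  P (joint @^-1` box B) = (\prod_i P (X i @^-1` B i))%E.
Proof.
move=> mB; rewrite -indX//; congr (P _).
by apply/seteqP; split=> w Bw i; [move=> _; exact: Bw|exact: (Bw i)].
Qed.

Lemma measurable_upd_joint i : measurable_fun setT
  (fun z : measurableTypeR R * T => upd (joint z.2) i z.1).
Proof.
apply: measurable_fun_cfg => j; rewrite /upd; case: (j == i).
  exact: measurable_fst.
by apply: (measurableT_comp (f := X j)); last exact: measurable_snd.
Qed.

(* The law of [upd joint i x], with [x] of law [Q] independent of [joint],
   agrees with that of [joint] on boxes. *)
Lemma resample (i : I) (Q : probability (measurableTypeR R) R)
    (f : cfg -> \bar R) :
  (forall B : set R, measurable B -> P (X i @^-1` B) = Q B) ->
  measurable_fun [set: cfg] f -> (forall g, (0 <= f g)%E) ->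
  (\int[P]_w f (joint w) =
   \int[P]_w \int[Q]_x f (upd (joint w) i x))%E.
Proof.
move=> lawX mf f0.
pose F : measurableTypeR R * T -> cfg := fun z => upd (joint z.2) i z.1.
have mj := measurable_joint.
have mF : measurable_fun setT F := measurable_upd_joint i.
(* By Tonelli the iterated integral is one against the product measure; both sides are then
   integrals of [f] against image measures on [cfg], which remain to be compared. *)
rewrite -(@fubini_tonelli2 _ _ _ _ _ Q P (fun z => f (F z)))//; last first.
  exact: measurableT_comp mf mF.
rewrite -(ge0_integral_pushforward mF (product_measure1 Q P) measurableT)//.
rewrite -(ge0_integral_pushforward mj P measurableT)//.
pose mj' : {mfun T >-> cfg} := HB.pack joint (isMeasurableFun.Build _ _ _ _ _ mj).
pose mF' : {mfun _ >-> cfg} := HB.pack F (isMeasurableFun.Build _ _ _ _ _ mF).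
apply: (@eq_measure_integral _ _ _ _
  (pushforward (product_measure1 Q P) mF') (pushforward P mj')) => A mA _.
apply: (@measure_unique _ R cfg boxes (fun _ => setT) _ _ _ _
  (pushforward P mj') (pushforward (product_measure1 Q P) mF')) => //.
- exact: setI_closed_boxes.
- by move=> _; exists (fun=> setT) => //; apply/seteqP.
- by rewrite bigcup_const.
- move=> _ [B mB <-]; rewrite /= /pushforward /=.
  rewrite joint_box//.
  (* Freeing coordinate [i] makes the preimage of the box under [F] a rectangle, of measure a
     product. *)
  pose B' j := if j == i then setT else B j.
  have -> : F @^-1` box B = B i `*` (joint @^-1` box B').
    apply/seteqP; split=> -[x w] /=.
      move=> Bxw; split; first by have := Bxw i; rewrite /F/= /upd eqxx.
      by move=> j; have := Bxw j; rewrite /F/= /upd /B'; case: ifP.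
    move=> [Bx Bw] j; have := Bw j; rewrite /F/= /upd /B'.
    by case: eqP => // ->.
  have mB' j : measurable (B' j) by rewrite /B'; case: ifP.
  rewrite product_measure1E; [|exact: mB|]; last first.
    by rewrite -[X in measurable X]setTI; apply: (mj) => //; exact: measurable_box.
  transitivity (P (X i @^-1` B i) * P (joint @^-1` box B'))%E; last first.
    by rewrite lawX.
  rewrite joint_box//.
  rewrite (bigD1 i)//= [in RHS](bigD1 i)//= {1}/B' eqxx preimage_setT.
  rewrite probability_setT mul1e; congr (_ * _)%E.
  by apply: eq_bigr => j /negbTE ji; rewrite /B' ji.
- move=> k; rewrite /= /pushforward preimage_setT.
  by rewrite probability_setT ltry.
Qed.

End Resampling.

(** * Gaussian integrals of exponentials of squares *)

Lemma complete_square (F : fieldType) (m v u b D x : F) :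
  v != 0 -> D != 0 -> D + v * u ^+ 2 != 0 -> 2 != 0 :> F ->
  - (u * x + b) ^+ 2 / (2 * D) + - (x - m) ^+ 2 / (v * 2) =
  - (u * m + b) ^+ 2 / (2 * (D + v * u ^+ 2)) +
  - (x - (m * D - v * u * b) / (D + v * u ^+ 2)) ^+ 2 /
     (v * (D / (D + v * u ^+ 2)) * 2).
Proof.
move=> v0 D0 D'0 two; by field; rewrite v0 D0 D'0 two.
Qed.

Section Gaussian.
Context (R : realType).
Implicit Types (m s u b D x : R).

(** The Radon-Nikodym derivative of [normal_prob] and [normal_pdf] have the same integral over every
    measurable set, hence agree almost everywhere. *)
Lemma ge0_integral_normal_prob m s (f : R -> \bar R) :
  measurable_fun setT f -> (forall x, (0 <= f x)%E) ->
  (\int[normal_prob m s]_x f x =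
   \int[lebesgue_measure]_x (f x * (normal_pdf m s x)%:E))%E.
Proof.
move=> mf f0.
have dom := @normal_prob_dominates R m s.
rewrite -(Radon_Nikodym_SigmaFinite.change_of_variables dom f0 measurableT mf).
set g := Radon_Nikodym_SigmaFinite.f _ _.
have ig : lebesgue_measure.-integrable setT g.
  exact: Radon_Nikodym_SigmaFinite.f_integrable.
have mpdf : measurable_fun setT (fun x => (normal_pdf m s x)%:E).
  by apply/measurable_EFinP; exact: measurable_normal_pdf.
apply: ae_eq_integral => //.
- by apply: emeasurable_funM => //; exact: measurable_int ig.
- exact: emeasurable_funM.
- apply: ae_eqe_mul2l; apply: integral_ae_eq => // A _ mA.
  by rewrite -Radon_Nikodym_SigmaFinite.f_integral.
Qed.

Lemma measurable_expR_affine_sqr u b D :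
  measurable_fun setT (fun x => expR (- (u * x + b) ^+ 2 / (2 * D))).
Proof.
apply: measurableT_comp => //; apply: measurable_funM => //.
apply: measurableT_comp => //; apply: measurable_funX.
by apply: measurable_funD => //; apply: measurable_funM.
Qed.

(* [D] may be negative, which gives the exponential moments of [x ^+ 2]. *)
Lemma integral_normal_expR m s u b D :
  0 < s -> D != 0 -> 0 < D / (D + s ^+ 2 * u ^+ 2) ->
  (\int[normal_prob m s]_x (expR (- (u * x + b) ^+ 2 / (2 * D)))%:E =
   (Num.sqrt (D / (D + s ^+ 2 * u ^+ 2)) *
    expR (- (u * m + b) ^+ 2 / (2 * (D + s ^+ 2 * u ^+ 2))))%:E)%E.
Proof.
move=> s0 D0; set D' := D + _; set q := D / D' => q0.
have D'0 : D' != 0 by apply: contraTneq q0 => D'0; rewrite /q D'0 invr0 mulr0 ltxx.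
rewrite ge0_integral_normal_prob; last 2 first.
- by apply/measurable_EFinP; exact: measurable_expR_affine_sqr.
- by move=> x; rewrite lee_fin expR_ge0.
(* Completing the square turns the integrand times the density into the constant [K] times the
   normal density of mean [m'] and deviation [s'], which has integral 1. *)
pose s' := s * Num.sqrt q.
pose m' := (m * D - s ^+ 2 * u * b) / D'.
have sq0 : 0 < Num.sqrt q by rewrite sqrtr_gt0.
have s'0 : 0 < s' by rewrite mulr_gt0.
have s'2 : s' ^+ 2 = s ^+ 2 * q by rewrite exprMn sqr_sqrtr// ltW.
pose K := Num.sqrt q * expR (- (u * m + b) ^+ 2 / (2 * D')).
have K0 : 0 <= K by rewrite mulr_ge0// ?expR_ge0// ltW.
transitivity (\int[lebesgue_measure]_x (K%:E * (normal_pdf m' s' x)%:E))%E; last first.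
  rewrite ge0_integralZl//; last 2 first.
  - by apply/measurable_EFinP; exact: measurable_normal_pdf.
  - by move=> x _; rewrite lee_fin normal_pdf_ge0.
  by rewrite integral_normal_pdf mule1.
apply: eq_integral => x _; rewrite -!EFinM; congr EFin.
rewrite !normal_pdfE ?gt_eqF// /normal_fun.
have -> : normal_peak s = Num.sqrt q * normal_peak s'.
  rewrite /normal_peak s'2.
  have -> : s ^+ 2 * q * pi *+ 2 = q * (s ^+ 2 * pi *+ 2) by ring.
  by rewrite (@sqrtrM _ q) ?ltW// invfM mulrA divff ?mul1r// gt_eqF.
rewrite /K mulrCA -expRD.
rewrite -[RHS]mulrA [in RHS](mulrCA (expR _)) -expRD mulrA; congr (_ * expR _).
rewrite s'2 -(mulr_natr (s ^+ 2)) -(mulr_natr (s ^+ 2 * q)).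
by apply: complete_square; rewrite // ?pnatr_eq0// expf_neq0// gt_eqF.
Qed.

End Gaussian.

(** * Small-ball probability of a Gaussian linear form with random coefficients *)

Section Anticoncentration.
Context (R : realType) (I : finType).
Context d (T : measurableType d) (P : probability T R) (X : I -> {RV P >-> R}).
Hypothesis indX : mutually_independent X.
Context (mu : I -> R) (s : R).
Hypothesis s_gt0 : 0 < s.
Hypothesis lawX : forall i (B : set R), measurable B ->
  P (X i @^-1` B) = normal_prob (mu i) s B.

Local Notation cfg := (cfg R I).

Lemma resample_normal (i : I) (f : cfg -> \bar R) :
  measurable_fun [set: cfg] f -> (forall g, (0 <= f g)%E) ->
  (\int[P]_w f (joint X w) =
   \int[P]_w \int[normal_prob (mu i) s]_x f (upd (joint X w) i x))%E.
Proof.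
by apply: (resample indX) => B mB; exact: lawX.
Qed.

(** On nonnegative values inversion is the real power of exponent [-1], which is measurable. *)
Lemma measurable_inv_ge0 d' (S : measurableType d') (f : S -> R) :
  (forall x, 0 <= f x) -> measurable_fun setT f ->
  measurable_fun setT (fun x => (f x)^-1).
Proof.
move=> f0 mf; under eq_fun do rewrite -powR_inv1//.
exact: (measurableT_comp (measurable_powR _)).
Qed.

Lemma measurable_sqrt : measurable_fun setT (@Num.sqrt R).
Proof. by apply: continuous_measurable_fun => x; exact: sqrt_continuous. Qed.

Section LinearForm.
Context (k : nat) (J : 'I_k -> I) (c : 'I_k -> cfg -> R) (t : R).
Hypothesis J_inj : injective J.
Hypothesis mc : forall j, measurable_fun setT (c j).
Hypothesis c_upd : forall j l g x, c j (upd g (J l) x) = c j g.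
Hypothesis t_gt0 : 0 < t.

Definition sqr_coef (g : cfg) := \sum_j c j g ^+ 2.

Definition lin_form (g : cfg) := \sum_j c j g * g (J j).

(* [test l] is what remains of [expR (- L ^+ 2 / (2 * t ^+ 2 * C))], with
   [L] the linear form and [C] the sum of the squared coefficients, once the
   variables [J j], [j < l], are integrated out. *)
Let mean_form l (g : cfg) :=
  \sum_j c j g * (if (j < l)%N then mu (J j) else g (J j)).

Let variance l (g : cfg) :=
  t ^+ 2 * sqr_coef g + s ^+ 2 * \sum_(j < k) (if (j < l)%N then c j g ^+ 2 else 0).

Let test l (g : cfg) : R :=
  if 0 < sqr_coef g then Num.sqrt (t ^+ 2 * sqr_coef g / variance l g) *
    expR (- mean_form l g ^+ 2 / (2 * variance l g)) else 0.

Lemma measurable_sqr_coef : measurable_fun setT sqr_coef.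
Proof. by apply: measurable_sum => j; exact: measurable_funX. Qed.

Lemma measurable_lin_form : measurable_fun setT lin_form.
Proof.
apply: measurable_sum => j; apply: measurable_funM => //.
exact: measurable_coord.
Qed.

Let sqr_coef_ge0 g : 0 <= sqr_coef g.
Proof. by apply: sumr_ge0 => j _; exact: sqr_ge0. Qed.

Let variance_ge0 l g : 0 <= variance l g.
Proof.
rewrite addr_ge0// mulr_ge0// ?sqr_ge0//.
by apply: sumr_ge0 => j _; case: ifP; rewrite ?sqr_ge0.
Qed.

Let variance_gt0 l g : 0 < sqr_coef g -> 0 < variance l g.
Proof.
move=> C0; rewrite ltr_wpDr ?mulr_gt0 ?exprn_gt0// mulr_ge0 ?sqr_ge0//.
by apply: sumr_ge0 => j _; case: ifP; rewrite ?sqr_ge0.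
Qed.

Let test_ge0 l g : 0 <= test l g.
Proof. by rewrite /test; case: ifP => // _; rewrite mulr_ge0 ?sqrtr_ge0 ?expR_ge0. Qed.

Let measurable_test l : measurable_fun setT (test l).
Proof.
have mC := measurable_sqr_coef.
have mV : measurable_fun setT (variance l).
  apply: measurable_funD; apply: measurable_funM => //.
  apply: measurable_sum => j; case: (j < l)%N => //.
  exact: measurable_funX.
have mM : measurable_fun setT (mean_form l).
  apply: measurable_sum => j; apply: measurable_funM => //.
  by case: (j < l)%N => //; exact: measurable_coord.
apply: measurable_fun_ifT => //.
- exact: measurable_fun_ltr.
- apply: measurable_funM.
    apply: (measurableT_comp measurable_sqrt); apply: measurable_funM.
      exact: measurable_funM.
    exact: measurable_inv_ge0.
  apply: measurableT_comp => //; apply: measurable_funM.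
    by apply: measurableT_comp => //; exact: measurable_funX.
  by apply: measurable_inv_ge0; [move=> g; rewrite mulr_ge0|exact: measurable_funM].
Qed.

(** By [c_upd] the coefficients are constant in the variable [J l], so [test l] is an exponential of
    the square of an affine function of it, and the Gaussian integral adds [s ^+ 2 * c l g ^+ 2] to
    the variance. *)
Let test_step l (lk : (l < k)%N) g :
  (\int[normal_prob (mu (J (Ordinal lk))) s]_x
     (test l (upd g (J (Ordinal lk)) x))%:E = (test l.+1 g)%:E)%E.
Proof.
set i := Ordinal lk.
have Cu x : sqr_coef (upd g (J i) x) = sqr_coef g.
  by apply: eq_bigr => j _; rewrite c_upd.
have Vu x : variance l (upd g (J i) x) = variance l g.
  by rewrite /variance Cu; under eq_bigr do rewrite c_upd.
pose b := \sum_(j < k | j != i)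
  c j g * (if (j < l)%N then mu (J j) else g (J j)).
have Mu x : mean_form l (upd g (J i) x) = c i g * x + b.
  rewrite /mean_form (bigD1 i)//= ltnn c_upd /upd eqxx; congr (_ + _).
  apply: eq_bigr => j ji; rewrite -/(upd g (J i) x) c_upd.
  by rewrite (inj_eq J_inj) (negbTE ji).
have MS : mean_form l.+1 g = c i g * mu (J i) + b.
  rewrite /mean_form (bigD1 i)//= ltnSn; congr (_ + _).
  apply: eq_bigr => j ji; rewrite ltnS leq_eqVlt.
  by rewrite (_ : (j == l :> nat) = false)//; exact: negbTE.
have VS : variance l.+1 g = variance l g + s ^+ 2 * c i g ^+ 2.
  rewrite /variance -addrA -mulrDr; congr (_ + _ * _).
  rewrite (bigD1 i)//= ltnSn addrC [in RHS](bigD1 i)//= ltnn add0r.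
  congr (_ + _); apply: eq_bigr => j ji; rewrite ltnS leq_eqVlt.
  by rewrite (_ : (j == l :> nat) = false)//; exact: negbTE.
rewrite /test; under eq_integral do rewrite Cu Vu Mu.
have [C0|_] := ltP 0 (sqr_coef g); last by rewrite integral0.
have V0 := variance_gt0 l C0.
under eq_integral do rewrite EFinM.
rewrite ge0_integralZl//; last first.
  by apply/measurable_EFinP; exact: measurable_expR_affine_sqr.
have V10 : 0 < variance l.+1 g := variance_gt0 l.+1 C0.
rewrite integral_normal_expR ?gt_eqF//; last by rewrite -VS divr_gt0.
(* The factor from the integral is the root of [variance l g / variance l.+1 g], so the product of
   square roots telescopes. *)
rewrite -VS -MS -EFinM mulrA -sqrtrM ?divr_ge0 ?mulr_ge0 ?exprn_ge0 ?(ltW t_gt0)//.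
by rewrite mulrA divfK ?gt_eqF// ltW.
Qed.

Let integral_test l : (l <= k)%N ->
  (\int[P]_w (test 0 (joint X w))%:E = \int[P]_w (test l (joint X w))%:E)%E.
Proof.
elim: l => // l IH lk; rewrite IH ?(ltnW lk)//.
rewrite (resample_normal (J (Ordinal lk)) (f := fun g => (test l g)%:E))//.
- by apply: eq_integral => w _; exact: test_step.
- by apply/measurable_EFinP; exact: measurable_test.
- by move=> g; rewrite lee_fin.
Qed.

(** With all variables integrated out the variance is [(t ^+ 2 + s ^+ 2) * sqr_coef g]: the
    coefficients cancel in the square root, and the exponential is at most 1. *)
Let test_le g : test k g <= t / s.
Proof.
have ts0 : 0 <= t / s by rewrite divr_ge0 ?ltW.
rewrite /test; case: ifP => [C0|//].
have V0 := variance_gt0 k C0.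
rewrite -[leRHS]mulr1 ler_pM ?sqrtr_ge0 ?expR_ge0//; last first.
  rewrite -expR0 ler_expR mulNr oppr_le0 divr_ge0 ?sqr_ge0//.
  by rewrite mulr_ge0// ltW.
rewrite -(ger0_norm ts0) -sqrtr_sqr ler_wsqrtr//.
rewrite ler_pdivrMr// exprMn exprVn [leRHS]mulrAC ler_pdivlMr ?exprn_gt0//.
rewrite -mulrA ler_pM2l ?exprn_gt0// /variance mulrC.
under eq_bigr do rewrite ltn_ord.
by rewrite ler_wpDl// mulr_ge0// sqr_ge0.
Qed.

(** The first condition excludes vanishing coefficients, for which the second would hold
    trivially. *)
Definition small_form : set cfg :=
  [set g | 0 < sqr_coef g /\ lin_form g ^+ 2 <= t ^+ 2 * sqr_coef g].

Lemma measurable_small_form : measurable (joint X @^-1` small_form).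
Proof.
rewrite -[X in measurable X]setTI; apply: (measurable_joint X) => //.
have mC := measurable_sqr_coef; have mL := measurable_lin_form.
apply: (measurableI [set g | 0 < sqr_coef g]
  [set g | lin_form g ^+ 2 <= t ^+ 2 * sqr_coef g]);
  rewrite -[X in measurable X]setTI.
  exact: measurable_fun_ltr.
by apply: measurable_fun_ler => //; [exact: measurable_funX|exact: measurable_funM].
Qed.

Lemma anticoncentration :
  (P (joint X @^-1` small_form) <= (expR 2^-1 * (t / s))%:E)%E.
Proof.
have mA := measurable_small_form; set A := _ @^-1` _ in mA *.
have mj := measurable_joint X.
rewrite -(setIT A) -(integral_indic P measurableT mA).
apply: (@le_trans _ _ (\int[P]_w (expR 2^-1 * test 0 (joint X w))%:E)%E).
  apply: ge0_le_integral => //.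
  - by apply/measurable_EFinP; exact: measurable_indic.
  - apply/measurable_EFinP; apply: measurable_funM => //.
    exact: (measurableT_comp (measurable_test 0)).
  move=> w _; rewrite indicE; have [/set_mem[C0 LC]|_] := boolP (w \in A); last first.
    by rewrite lee_fin mulr_ge0 ?expR_ge0.
  (* Before any integration the square root is 1, and on [A] the exponent is at least [- 1/2], which
     the factor [expR 2^-1] compensates. *)
  rewrite lee_fin /test C0 /variance big1_eq mulr0 addr0.
  have V0 : 0 < t ^+ 2 * sqr_coef (joint X w) by rewrite mulr_gt0// exprn_gt0.
  rewrite divff ?gt_eqF// sqrtr1 mul1r -expRD -expR0 ler_expR.
  rewrite mulNr subr_ge0 invfM mulrCA ler_piMr// ler_pdivrMr// mul1r.
  exact: LC.
under eq_integral do rewrite EFinM.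
rewrite ge0_integralZl//; last 2 first.
- by apply/measurable_EFinP; exact: (measurableT_comp (measurable_test 0)).
- by move=> w _; rewrite lee_fin.
rewrite EFinM (integral_test (leqnn k)) lee_pmul2l ?lte_fin ?expR_gt0//.
rewrite -[leRHS]mule1 -(probability_setT P) -integral_cst//.
apply: ge0_le_integral => //.
- by move=> w _; rewrite lee_fin.
- by apply/measurable_EFinP; exact: (measurableT_comp (measurable_test k)).
- by move=> w _; rewrite lee_fin.
Qed.

End LinearForm.
End Anticoncentration.

(** * Frobenius norm, pseudoinverse and operator norm *)

Section FrobeniusNorm.
Context (R : realType).

Lemma frob2_ge0 m n (A : 'M[R]_(m, n)) : 0 <= frob2 A.
Proof. by apply: sumr_ge0 => i _; apply: sumr_ge0 => j _; exact: sqr_ge0. Qed.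

Lemma frob2_trace m n (A : 'M[R]_(m, n)) : frob2 A = \tr (A^T *m A).
Proof.
rewrite /frob2 exchange_big; apply: eq_bigr => j _; rewrite mxE.
by apply: eq_bigr => i _; rewrite mxE expr2.
Qed.

Lemma frob2D_le m n (A B : 'M[R]_(m, n)) :
  frob2 (A + B) <= 2 * frob2 A + 2 * frob2 B.
Proof.
rewrite /frob2 !mulr_sumr -big_split; apply: ler_sum => i _.
rewrite !mulr_sumr -big_split; apply: ler_sum => j _ /=; rewrite mxE.
have := sqr_ge0 (A i j - B i j); nra.
Qed.

Lemma frob2_col_mx m1 m2 n (A : 'M[R]_(m1, n)) (B : 'M[R]_(m2, n)) :
  frob2 (col_mx A B) = frob2 A + frob2 B.
Proof.
rewrite /frob2 big_split_ord; congr (_ + _); apply: eq_bigr => i _;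
  by apply: eq_bigr => j _; rewrite ?col_mxEu ?col_mxEd.
Qed.

Lemma frob2_0 m n : frob2 (0 : 'M[R]_(m, n)) = 0.
Proof. by rewrite /frob2 big1// => i _; rewrite big1// => j _; rewrite mxE expr0n. Qed.

(** Pythagoras for the orthogonal projection [Q]: the difference of the two sides is
    [frob2 (Y - Q *m Y)]. *)
Lemma frob2_proj_le n p (Q : 'M[R]_n) (Y : 'M[R]_(n, p)) :
  Q^T = Q -> Q *m Q = Q -> frob2 (Q *m Y) <= frob2 Y.
Proof.
move=> QT QQ; rewrite -subr_ge0.
suff -> : frob2 Y - frob2 (Q *m Y) = frob2 (Y - Q *m Y) by exact: frob2_ge0.
rewrite !frob2_trace -raddfB; congr (\tr _).
have QY : (Q *m Y)^T *m (Q *m Y) = Y^T *m (Q *m Y).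
  by rewrite trmx_mul QT -!mulmxA (mulmxA Q Q) QQ.
rewrite [(Y - _)^T]raddfB/= mulmxBl !mulmxBr QY.
by rewrite trmx_mul QT -!mulmxA subrr subr0.
Qed.

(** A pseudoinverse [Z] equals [(Z *m A) *m Y], and [Z *m A] is an orthogonal projection by the
    Penrose equations. *)
Lemma frob2_mpinv_le m n (A : 'M[R]_(m, n)) (Y : 'M[R]_(n, m)) :
  A *m Y = 1%:M -> frob2 (mpinv A) <= frob2 Y.
Proof.
(* If [xget] falls back on its default 0, the bound is trivial. *)
move=> AY; rewrite /mpinv; case: xgetP => [Z _ [AZA ZAZ _ ZAT]|_]; last first.
  by rewrite frob2_0 frob2_ge0.
have -> : Z = (Z *m A) *m Y by rewrite -mulmxA AY mulmx1.
by apply: frob2_proj_le => //; rewrite mulmxA ZAZ.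
Qed.

(** By the adjugate formula column [j] of the inverse is the vector of cofactors of row [j] divided
    by the determinant, so its squared norm is at most [1 / t ^+ 2]. *)
Lemma frob2_invmx_le m (B : 'M[R]_m) (t : R) : 0 < t -> \det B != 0 ->
  (forall i, t ^+ 2 * \sum_j cofactor B i j ^+ 2 <= \det B ^+ 2) ->
  frob2 (invmx B) <= m%:R / t ^+ 2.
Proof.
move=> t0 D0 tB; rewrite /invmx unitmxE unitfE D0.
rewrite /frob2 exchange_big/= -[m in m%:R]card_ord -sum1_card natr_sum mulr_suml.
apply: ler_sum => j _; rewrite mul1r.
under eq_bigr do rewrite mxE mxE exprMn exprVn.
rewrite -mulr_sumr mulrC ler_pdivrMr ?exprn_even_gt0//.
by rewrite ler_pdivlMl ?exprn_gt0.
Qed.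

Lemma vnorm_mulmx_le_opnorm m n (A : 'M[R]_(m, n)) (x : 'cV[R]_n) :
  vnorm x = 1 -> vnorm (A *m x) <= opnorm A.
Proof.
move=> x1; apply: ub_le_sup; last by exists x.
(* The supremum needs an upper bound: a unit vector has entries of absolute value at most 1, so each
   entry of the image is bounded by an absolute row sum. *)
exists (Num.sqrt (\sum_i (\sum_j `|A i j|) ^+ 2)) => _ [y /= y1 <-].
apply: ler_wsqrtr; apply: ler_sum => i _.
rewrite -real_normK ?num_real// ler_sqr ?nnegrE ?sumr_ge0// mxE.
apply: le_trans (ler_norm_sum _ _ _) _; apply: ler_sum => j _.
rewrite normrM ler_piMr// -y1 -sqrtr_sqr ler_wsqrtr//.
by rewrite (bigD1 j)//= lerDl sumr_ge0// => k _; exact: sqr_ge0.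
Qed.

(** Each of the [n] columns is the image of a unit basis vector. *)
Lemma frob2_le_opnorm m n (A : 'M[R]_(m, n)) :
  frob2 A <= n%:R * opnorm A ^+ 2.
Proof.
rewrite /frob2 exchange_big/= -[n in n%:R]card_ord -sum1_card natr_sum mulr_suml.
apply: ler_sum => j _; rewrite mul1r.
pose e : 'cV[R]_n := delta_mx j 0.
have e1 : vnorm e = 1.
  rewrite /vnorm (bigD1 j)//= big1 => [|i ij].
    by rewrite mxE !eqxx expr1n addr0 sqrtr1.
  by rewrite mxE (negbTE ij) expr0n.
have := vnorm_mulmx_le_opnorm A e1; rewrite -colE => Ae.
have -> : \sum_i A i j ^+ 2 = vnorm (col j A) ^+ 2.
  rewrite sqr_sqrtr; last by apply: sumr_ge0 => i _; exact: sqr_ge0.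
  by apply: eq_bigr => i _; rewrite mxE.
by rewrite lerXn2r ?nnegrE ?(le_trans _ Ae) ?sqrtr_ge0.
Qed.

End FrobeniusNorm.

(** * Random minors, almost sure invertibility and the Frobenius tail *)

Section RandomMinors.
Context (R : realType) (I : finType).
Context d (T : measurableType d) (P : probability T R) (X : I -> {RV P >-> R}).
Hypothesis indX : mutually_independent X.
Context (mu : I -> R) (s : R).
Hypothesis s_gt0 : 0 < s.
Hypothesis lawX : forall i (B : set R), measurable B ->
  P (X i @^-1` B) = normal_prob (mu i) s B.

Local Notation cfg := (cfg R I).

(** The index map [e] says which variable sits at each position; submatrices are then again of this
    form, as the induction on the size requires. *)
Definition minor k (e : 'I_k -> 'I_k -> I) (g : cfg) : 'M[R]_k :=
  \matrix_(a, b) g (e a b).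

Definition pair_inj k (e : 'I_k -> 'I_k -> I) :=
  forall a b a' b', e a b = e a' b' -> a = a' /\ b = b'.

Definition sub_index k (e : 'I_k -> 'I_k -> I) (i j : 'I_k) a b :=
  e (lift i a) (lift j b).

Lemma cofactor_minor k (e : 'I_k -> 'I_k -> I) g i j :
  cofactor (minor e g) i j =
  (-1) ^+ (i + j) * \det (minor (sub_index e i j) g).
Proof.
by congr (_ * \det _); apply/matrixP => a b; rewrite !mxE.
Qed.

Lemma sub_index_inj k (e : 'I_k -> 'I_k -> I) i j :
  pair_inj e -> pair_inj (sub_index e i j).
Proof.
by move=> e_inj a b a' b' /e_inj[]; do 2 move/lift_inj => ->.
Qed.

Lemma measurable_det k (e : 'I_k -> 'I_k -> I) :
  measurable_fun setT (fun g : cfg => \det (minor e g)).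
Proof.
apply: measurable_sum => p; apply: measurable_funM => //.
apply: measurable_prod => i _; under eq_fun do rewrite mxE.
exact: measurable_coord.
Qed.

Lemma measurable_cofactor k (e : 'I_k -> 'I_k -> I) i j :
  measurable_fun setT (fun g : cfg => cofactor (minor e g) i j).
Proof.
under eq_fun do rewrite cofactor_minor.
by apply: measurable_funM => //; exact: measurable_det.
Qed.

(** The cofactors of row [i] omit that row, and by injectivity the variable [e i l] occurs nowhere
    else. This supplies [c_upd] for the determinant as a linear form in row [i]. *)
Lemma cofactor_upd k (e : 'I_k -> 'I_k -> I) i j l g x : pair_inj e ->
  cofactor (minor e (upd g (e i l) x)) i j = cofactor (minor e g) i j.
Proof.
move=> e_inj; rewrite !cofactor_minor; congr (_ * \det _).
apply/matrixP => a b; rewrite !mxE /upd; case: eqP => // /e_inj[/eqP].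
by rewrite eq_sym (negbTE (neq_lift _ _)).
Qed.

(* Row [i] of [minor e g] is within distance [t] of the span of the other rows,
   which are linearly independent. *)
Definition near_singular k (e : 'I_k -> 'I_k -> I) (i : 'I_k) (t : R) :=
  small_form (e i) (fun j g => cofactor (minor e g) i j) t.

Lemma lin_form_minor k (e : 'I_k -> 'I_k -> I) i g :
  lin_form (e i) (fun j g => cofactor (minor e g) i j) g = \det (minor e g).
Proof.
rewrite (expand_det_row _ i); apply: eq_bigr => j _.
by rewrite mxE mulrC.
Qed.

Lemma measurable_near_singular k (e : 'I_k -> 'I_k -> I) i t :
  measurable (joint X @^-1` near_singular e i t).
Proof.
by apply: measurable_small_form => j; exact: measurable_cofactor.
Qed.

Lemma near_singular_le k (e : 'I_k -> 'I_k -> I) i t : pair_inj e -> 0 < t ->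
  (P (joint X @^-1` near_singular e i t) <= (expR 2^-1 * (t / s))%:E)%E.
Proof.
move=> e_inj t0; apply: (anticoncentration indX s_gt0 lawX) => //.
- by move=> j j' /e_inj[].
- by move=> j; exact: measurable_cofactor.
- by move=> j l g x; exact: cofactor_upd.
Qed.

Definition singular k (e : 'I_k -> 'I_k -> I) : set cfg :=
  [set g | \det (minor e g) = 0].

Lemma measurable_singular k (e : 'I_k -> 'I_k -> I) :
  measurable (joint X @^-1` singular e).
Proof.
rewrite -[X in measurable X]setTI; apply: (measurable_joint X) => //.
rewrite -[X in measurable X]setTI.
exact: (measurable_det e measurableT (measurable_set1 (0 : R))).
Qed.

(** Induction on the size: a singular minor has either a singular submatrix, a null event by
    induction, or a nonzero cofactor in its first row. In the latter case that row is near-singular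
    for every [t], an event of arbitrarily small probability. *)
Lemma singular_null k (e : 'I_k -> 'I_k -> I) : pair_inj e ->
  P (joint X @^-1` singular e) = 0%E.
Proof.
elim: k e => [|k IH] e e_inj.
  rewrite (_ : _ @^-1` _ = set0) ?measure0//.
  by apply/seteqP; split=> w //=; rewrite /singular/= det_mx00 => /eqP/[!oner_eq0].
apply/eqP; rewrite eq_le measure_ge0 andbT.
apply/lee_addgt0Pr => eps eps0; rewrite add0e.
(* Chosen so that [expR 2^-1 * (t / s)] equals [eps]. *)
pose t := eps * s / expR 2^-1.
have t0 : 0 < t by rewrite divr_gt0 ?mulr_gt0 ?expR_gt0.
pose e' := sub_index e ord0 ord0.
have e'_inj : pair_inj e' := sub_index_inj e_inj.
apply: (@le_trans _ _ (P (joint X @^-1` near_singular e ord0 t `|`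
                          joint X @^-1` singular e'))).
  apply: le_measure; rewrite ?inE; [|apply: measurableU|].
  - exact: measurable_singular.
  - exact: measurable_near_singular.
  - exact: measurable_singular.
  move=> w /= D0; rewrite /singular/=.
  have [->|D'0] := eqVneq (\det (minor e' (joint X w))) 0; [by right|left].
  have C0 : 0 < sqr_coef (fun j g => cofactor (minor e g) ord0 j) (joint X w).
    rewrite /sqr_coef (bigD1 ord0)//= ltr_pwDl ?sumr_ge0// => [|j _].
      by rewrite exprn_even_gt0// cofactor_minor mulf_neq0// signr_eq0.
    exact: sqr_ge0.
  split => //; rewrite lin_form_minor D0 expr0n/=.
  by rewrite mulr_ge0 ?sqr_ge0// ltW.
have U2 : (P (joint X @^-1` near_singular e ord0 t `|`
              joint X @^-1` singular e') <=
           P (joint X @^-1` near_singular e ord0 t) +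
           P (joint X @^-1` singular e'))%E.
  by apply: measureU2; [exact: measurable_near_singular|exact: measurable_singular].
apply: (le_trans U2); rewrite (IH e')// adde0.
apply: le_trans (near_singular_le _ e_inj t0) _.
by rewrite lee_fin /t (mulrAC eps) mulfK ?gt_eqF// mulrC divfK//.
Qed.

(** Markov's inequality, with the second moment bounded through [y <= expR y] at
    [y = (x - mu i) ^+ 2 / (4 * s ^+ 2)]. The exponential has mean [Num.sqrt 2 <= 3 / 2], whence the
    constant [6 = 4 * 3 / 2]. *)
Lemma deviation_tail (a : R) : 0 < a ->
  (P [set w | (a <= \sum_i (X i w - mu i) ^+ 2)%R] <=
   (#|I|%:R * (6 * s ^+ 2) / a)%:E)%E.
Proof.
move=> a0; set A := [set w | _].
have mX i : measurable_fun setT (X i) by exact: measurable_funPT.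
have mdev i : measurable_fun setT (fun w => (X i w - mu i) ^+ 2).
  by apply: measurable_funX; apply: measurable_funB.
have mA : measurable A.
  rewrite -[X in measurable X]setTI; apply: measurable_fun_ler => //.
  exact: measurable_sum.
(* The Gaussian integral is applied with the negative value [D = - 2 * s ^+ 2]. *)
pose h i x := expR (- (1 * x + (- mu i)) ^+ 2 / (2 * ((- 2) * s ^+ 2))).
have mh i : measurable_fun setT (h i) by exact: measurable_expR_affine_sqr.
have h0 i x : 0 <= h i x by exact: expR_ge0.
have s2 : 0 < s ^+ 2 by rewrite exprn_gt0.
have Dq : (- 2) * s ^+ 2 / ((- 2) * s ^+ 2 + s ^+ 2 * 1 ^+ 2) = 2.
  rewrite (_ : (- 2) * s ^+ 2 + s ^+ 2 * 1 ^+ 2 = - s ^+ 2); last by ring.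
  by rewrite invrN mulrN mulfK ?opprK ?gt_eqF//.
have D0 : (- 2) * s ^+ 2 != 0.
  by rewrite mulf_neq0 ?oppr_eq0 ?pnatr_eq0// gt_eqF.
have Eh i : (\int[P]_w (h i (X i w))%:E <= (3 / 2)%:E)%E.
  rewrite (resample_normal indX lawX i (f := fun g => (h i (g i))%:E)); last 2 first.
  - by apply/measurable_EFinP; apply: (measurableT_comp (mh i)); exact: measurable_coord.
  - by move=> g; rewrite lee_fin.
  have E1 w : (\int[normal_prob (mu i) s]_x (h i (upd (joint X w) i x i))%:E =
               (Num.sqrt 2)%:E)%E.
    under eq_integral do rewrite /upd eqxx.
    rewrite integral_normal_expR ?Dq//.
    by rewrite mul1r subrr expr0n oppr0 mul0r expR0 mulr1.
  under eq_integral do rewrite E1.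
  rewrite integral_cst//= probability_setT mule1 lee_fin.
  rewrite -[leRHS]ger0_norm// -sqrtr_sqr ler_wsqrtr//; lra.
have devh i w : (X i w - mu i) ^+ 2 <= 4 * s ^+ 2 * h i (X i w).
  have -> : h i (X i w) = expR ((X i w - mu i) ^+ 2 / (4 * s ^+ 2)).
    rewrite /h mul1r; congr expR; rewrite mulNr -mulrN -invrN.
    by congr (_ / _); ring.
  rewrite -ler_pdivrMl ?mulr_gt0// mulrC.
  by apply: le_trans (expR_ge1Dx _); rewrite lerDr.
rewrite EFinM lee_pdivlMr//.
have mhX i : measurable_fun setT (fun w => ((4 * s ^+ 2)%:E * (h i (X i w))%:E)%E).
  apply/measurable_EFinP; apply: measurable_funM => //.
  exact: (measurableT_comp (mh i)).
have s4 : 0 <= 4 * s ^+ 2 by rewrite mulr_ge0// ltW.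
apply: (@le_trans _ _ (\int[P]_w (\sum_i (4 * s ^+ 2)%:E * (h i (X i w))%:E))%E).
  rewrite muleC -(setIT A) -(integral_indic P measurableT mA).
  rewrite -ge0_integralZl//; last 2 first.
  - by apply/measurable_EFinP; exact: measurable_indic.
  - by rewrite lee_fin ltW.
  apply: ge0_le_integral => //.
  - by move=> w _; rewrite mule_ge0// lee_fin ltW.
  - by apply/measurable_EFinP; apply: measurable_funM.
  - exact: emeasurable_sum.
  move=> w _; under eq_bigr do rewrite -EFinM.
  rewrite sumEFin -EFinM lee_fin indicE.
  apply: (@le_trans _ _ (\sum_i (X i w - mu i) ^+ 2)); last exact: ler_sum.
  have [/set_mem|_] := boolP (w \in A); first by rewrite mulr1.
  by rewrite mulr0 sumr_ge0// => i _; exact: sqr_ge0.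
rewrite ge0_integral_sum//; last first.
  by move=> i w _; rewrite mule_ge0// lee_fin.
apply: (@le_trans _ _ (\sum_(i : I) (6 * s ^+ 2)%:E)%E).
  apply: lee_sum => i _; rewrite ge0_integralZl//; last 2 first.
  - by apply/measurable_EFinP; exact: (measurableT_comp (mh i)).
  - by move=> w _; rewrite lee_fin.
  apply: (@le_trans _ _ ((4 * s ^+ 2)%:E * (3 / 2)%:E)%E).
    by rewrite lee_pmul2l ?lte_fin ?mulr_gt0//; exact: Eh.
  rewrite -EFinM lee_fin; lra.
by rewrite sumEFin lee_fin sumr_const -[leLHS]mulr_natl.
Qed.

End RandomMinors.

(** * Union bound, numerical estimates and conclusion *)

Lemma measure_bigsetU_le d (T : measurableType d) (R : realType)
    (mu : {measure set T -> \bar R}) (I : Type) (r : seq I) (A : I -> set T) :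
  (forall i, measurable (A i)) ->
  (mu (\big[setU/set0]_(i <- r) A i) <= \sum_(i <- r) mu (A i))%E.
Proof.
move=> mA; elim: r => [|i r IH]; first by rewrite !big_nil measure0.
rewrite !big_cons; apply: le_trans (leeD2l _ IH).
apply: measureU2 => //; exact: bigsetU_measurable.
Qed.

(* [h] stands for the square root of [e] and [r] for that of [N]. *)
Lemma failure_le (R : realType) (s h r N k : R) :
  0 < s -> 3 / 2 <= h -> 1 <= r -> N = r ^+ 2 -> 0 <= k -> k <= N ->
  k * (h * (s / (h ^+ 2 * (N * r)) / s)) +
  k * N * (6 * s ^+ 2) / (49 * s ^+ 2 * N ^+ 3) <= r^-1.
Proof.
move=> s0 h32 r1 -> k0 kN.
have r0 : 0 < r by lra.
have h0 : 0 < h by lra.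
have -> : k * (h * (s / (h ^+ 2 * (r ^+ 2 * r)) / s)) = k / r ^+ 2 * (r^-1 * h^-1).
  by field; rewrite !gt_eqF.
have -> : k * r ^+ 2 * (6 * s ^+ 2) / (49 * s ^+ 2 * (r ^+ 2) ^+ 3) =
    k / r ^+ 2 * (r^-1 * (6 / 49 * r^-1)).
  by field; rewrite !gt_eqF.
rewrite -mulrDr.
have q1 : k / r ^+ 2 <= 1 by rewrite ler_pdivrMr ?exprn_gt0// mul1r.
have q0 : 0 <= k / r ^+ 2 by rewrite divr_ge0// exprn_ge0// ltW.
(* The two summands contribute at most [2 / 3] and [6 / 49] of [r^-1], together less than 1. *)
have hi : h^-1 <= 2 / 3 by rewrite -[2 / 3]invrK lef_pV2 ?posrE//; lra.
have ri : r^-1 <= 1 by rewrite invf_le1.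
rewrite -[leRHS]mul1r ler_pM//.
  by rewrite -mulrDr mulr_ge0 ?addr_ge0 ?mulr_ge0 ?invr_ge0// ltW.
rewrite -mulrDr ler_piMr ?invr_ge0 ?(ltW r0)//; lra.
Qed.

Lemma kappaF_le (R : realType) m p (A B : 'M[R]_(m, m + p)) (t a : R) :
  0 < t -> \det (lsubmx A) != 0 ->
  (forall i, t ^+ 2 * \sum_j cofactor (lsubmx A) i j ^+ 2 <=
     \det (lsubmx A) ^+ 2) ->
  frob2 (A - B) <= a ->
  kappaF A <= 2 * a + 2 * (m + p)%:R * opnorm B ^+ 2 + m%:R / t ^+ 2.
Proof.
move=> t0 D0 tD ABa; rewrite /kappaF lerD//.
  rewrite -{1}(subrK B A); apply: le_trans (frob2D_le _ _) _.
  by rewrite lerD ?ler_pM2l// -mulrA ler_pM2l// frob2_le_opnorm.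
pose Y := col_mx (invmx (lsubmx A)) (0 : 'M[R]_(p, m)).
have AY : A *m Y = 1%:M.
  by rewrite -{1}(hsubmxK A) mul_row_col mulmx0 addr0 mulmxV// unitmxE unitfE.
apply: le_trans (frob2_mpinv_le AY) _.
by rewrite frob2_col_mx frob2_0 addr0 frob2_invmx_le.
Qed.

Theorem theorem6p5 (d : measure_display) (T : measurableType d) (R : realType)
  (P : probability T R) (m n : nat) (Abar : 'M[R]_(m, n)) (sigma : R)
  (X : 'I_m * 'I_n -> {RV P >-> R}) :
  (m <= n)%N -> 0 < sigma ->
  mutually_independent X ->
  (forall i j (B : set R), measurable B ->
     P (X (i, j) @^-1` B) = normal_prob (Abar i j) sigma B) ->
  exists2 E : set T, measurable E /\
    E `<=` [set w | kappaF (\matrix_(i < m, j < n) X (i, j) w) <=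
              98 * sigma ^+ 2 * n%:R ^+ 3 + 2 * n%:R * opnorm Abar ^+ 2
              + expR 1 ^+ 2 * n%:R ^+ 4 / sigma ^+ 2] &
    (((1 - ((Num.sqrt n%:R)^-1 + expR (- (2 * n%:R) / pi ^+ 2)))%:E <= P E)%E).
Proof.
move=> mn s0 indX lawX.
have [n0|n0] := posnP n.
  (* For [n = 0] the inverse of 0 is 0 by convention and the exponential is 1, so the required
     probability is 0. *)
  exists set0; first by split => //; exact: sub0set.
  by rewrite measure0 lee_fin n0 sqrtr0 invr0 add0r mulr0 oppr0 mul0r expR0 subrr.
have [p np] : exists p, n = (m + p)%N by exists (n - m)%N; rewrite subnKC.
subst n; set N : R := (m + p)%:R.
pose mu (ij : 'I_m * 'I_(m + p)) := Abar ij.1 ij.2.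
have lawX' ij (B : set R) : measurable B ->
    P (X ij @^-1` B) = normal_prob (mu ij) sigma B.
  by case: ij => i j; exact: lawX.
pose e (a b : 'I_m) : 'I_m * 'I_(m + p) := (a, lshift p b).
have e_inj : pair_inj e by move=> a b a' b' [-> bb]; split => //; exact: val_inj.
pose r := Num.sqrt N.
pose h : R := expR 2^-1.
have N1 : 1 <= N by rewrite ler1n.
have r2 : N = r ^+ 2 by rewrite sqr_sqrtr// ler0n.
have r1 : 1 <= r by rewrite -sqrtr1 ler_wsqrtr.
have r0 : 0 < r by apply: lt_le_trans r1.
have N0 : 0 < N by apply: lt_le_trans N1.
have h2 : expR 1 = h ^+ 2 by rewrite expr2 -expRD; congr expR; lra.
have h0 : 0 < h by exact: expR_gt0.
have h32 : 3 / 2 <= h by apply: le_trans (expR_ge1Dx _); lra.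
(* This makes [N / t ^+ 2] equal to the last term [expR 1 ^+ 2 * N ^+ 4 / sigma ^+ 2]. *)
pose t := sigma / (h ^+ 2 * (N * r)).
have t0 : 0 < t by rewrite divr_gt0 ?mulr_gt0 ?exprn_gt0.
(* Half of the term with 98, since [frob2D_le] doubles the squared norm of the deviation. *)
pose a := 49 * sigma ^+ 2 * N ^+ 3.
have a0 : 0 < a by rewrite !mulr_gt0 ?exprn_gt0.
pose near := \big[setU/set0]_(i < m) (joint X @^-1` near_singular e i t).
pose sing := joint X @^-1` singular e.
pose dev := [set w | a <= \sum_(ij : 'I_m * 'I_(m + p)) (X ij w - mu ij) ^+ 2].
have mnear : measurable near.
  by apply: bigsetU_measurable => i _; exact: measurable_near_singular.
have msing : measurable sing by exact: measurable_singular.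
have mdev : measurable dev.
  rewrite -[X in measurable X]setTI; apply: measurable_fun_ler => //.
  apply: measurable_sum => ij; apply: measurable_funX.
  by apply: measurable_funB => //; exact: measurable_funPT.
have mbad : measurable (near `|` sing `|` dev) by do 2 apply: measurableU => //.
exists (~` (near `|` sing `|` dev)).
  split; first exact: measurableC.
  move=> w /= /not_orP[/not_orP[wnear wsing] wdev].
  set A := \matrix_(i, j) X (i, j) w.
  have lA : lsubmx A = minor e (joint X w) by apply/matrixP => i j; rewrite !mxE.
  apply: (@le_trans _ _
    (2 * a + 2 * N * opnorm Abar ^+ 2 + m%:R / t ^+ 2)).
    apply: kappaF_le => //; rewrite ?lA; first exact/eqP.
    (* A row violating the bound would be near-singular: the strict inequality [Di] forces its
       cofactors not to vanish all together. *)
    - move=> i; rewrite leNgt; apply/negP => Di; apply: wnear.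
      rewrite /near (bigD1 i)//=; left; split.
        rewrite lt_neqAle sumr_ge0 ?andbT => [|j _]; last exact: sqr_ge0.
        apply: contraTneq Di => /esym C0.
        by rewrite [X in _ * X]C0 mulr0 -leNgt sqr_ge0.
      by rewrite lin_form_minor ltW.
    - have -> : frob2 (A - Abar) = \sum_(ij : 'I_m * 'I_(m + p)) (X ij w - mu ij) ^+ 2.
        rewrite /frob2 pair_bigA/=; apply: eq_bigr => -[i j] _.
        by rewrite !mxE.
      by rewrite ltW// ltNge; apply/negP.
  rewrite lerD//.
    by rewrite lerD// /a !mulrA -natrM.
  have -> : expR 1 ^+ 2 * N ^+ 4 / sigma ^+ 2 = N / t ^+ 2.
    rewrite /t h2 r2; field; rewrite !gt_eqF//.
  by rewrite ler_pM2r ?invr_gt0 ?exprn_gt0// ler_nat leq_addr.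
rewrite probability_setC//.
have Pnear : (P near <= (m%:R * (h * (t / sigma)))%:E)%E.
  apply: le_trans (measure_bigsetU_le _ _ _) _ => [i|].
    exact: measurable_near_singular.
  rewrite [leRHS](_ : _ = \sum_(i < m) (h * (t / sigma))%:E)%E.
    by apply: lee_sum => i _; exact: (near_singular_le indX s0 lawX').
  by rewrite sumEFin sumr_const card_ord mulr_natl.
have Psing : P sing = 0%E := singular_null indX s0 lawX' e_inj.
have Pdev : (P dev <= (m%:R * N * (6 * sigma ^+ 2) / a)%:E)%E.
  apply: le_trans (deviation_tail indX s0 lawX' a0) _.
  by rewrite card_prod !card_ord natrM.
have Pbad : (P (near `|` sing `|` dev) <= (r^-1)%:E)%E.
  apply: (@le_trans _ _ (P near + P sing + P dev)%E).
    apply: le_trans (measureU2 _ _ _) _ => //; first exact: measurableU.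
    by apply: leeD2r; exact: measureU2.
  rewrite Psing adde0; apply: le_trans (leeD Pnear Pdev) _.
  by rewrite -EFinD lee_fin failure_le// ler_nat leq_addr.
apply: (@le_trans _ _ (1 - r^-1)%:E); last by rewrite EFinB leeB.
by rewrite lee_fin lerD2l lerN2 lerDl expR_ge0.
Qed.
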